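(* The average search probability on a strongly regular graph approaches $1/4$ as the valency goes to infinity. That is, for any sequence of strongly regular graphs $X_1,X_2,\dots$ whose valencies tend to infinity, with any choice of marked vertex in each $X_j$, the average search probability on $X_j$ tends to $1/4$ as $j\to\infty$.
   Context: Graphs are finite and simple. A connected graph is distance regular if for any two vertices $u,v$ at distance $m$, the number of vertices at distance $i$ from $u$ and distance $j$ from $v$ depends only on $i,j,m$. A strongly regular graph here means a distance regular graph of diameter two. Quantum walk: let $X$ be a $k$-regular graph on $n$ vertices with marked vertex $a$. View each edge $\{u,v\}$ as two arcs $(u,v),(v,u)$ and consider complex functions on the $nk$ arcs, identified with $\mathbb{C}^n\otimes\mathbb{C}^k$ by grouping arcs by tail. Let $R$ be the permutation matrix swapping $(u,v)$ and $(v,u)$, $C=I_n\otimes(\frac2kJ_k-I_k)$ (i.e. $(Cf)(u,v)=\frac2k\sum_{w\sim u}f(u,w)-f(u,v)$), and $O_a=(I_n-2E_{aa})\otimes I_k$ (i.e. $O_a$ multiplies $f(u,v)$ by $-1$ if $u=a$ and by $1$ otherwise). The transition matrix is $U=RCO_a$ and the initial state is $x_0=\frac{1}{\sqrt{nk}}\mathbf{1}_{nk}$, where $\mathbf 1_{nk}$ is the all-ones vector. If $F_r$ are the orthogonal projections onto the eigenspaces of $U$ (one for each distinct eigenvalue), the average search probability is $$\sum_{v\sim a}\sum_r\big|e_{(a,v)}^TF_rx_0\big|^2,$$ which equals $\lim_{T\to\infty}\frac1T\sum_{t=0}^{T-1}\sum_{v\sim a}|e_{(a,v)}^TU^tx_0|^2$.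 *)

(* Defs.v *)
From HB Require Import structures.
From mathcomp Require Import all_boot all_order all_algebra.
From mathcomp Require Import spectral complex.
From mathcomp Require Import all_classical all_reals all_analysis.

Set Implicit Arguments.
Unset Strict Implicit.
Unset Printing Implicit Defensive.

Import Order.TTheory GRing.Theory Num.Theory.
Import numFieldNormedType.Exports.

Local Open Scope classical_set_scope.
Local Open Scope complex_scope.
Local Open Scope ring_scope.

Record sgraph := SGraph {
  vertex :> finType;
  adj : rel vertex;
  adj_sym : symmetric adj;
  adj_irrefl : irreflexive adj }.

Section Graph.
Variable G : sgraph.

Definition k_regular (k : nat) :=
  forall u : G, #|[set v | adj u v]%SET| = k.

Definition connected_graph := forall u v : G, connect (@adj G) u v.

Definition walk (n : nat) (u v : G) : bool :=
  [exists p : n.-tuple G, path (@adj G) u p && (last u p == v)].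

(* The least length of a walk from u to v. In a connected graph this is at most
   #|G|.-1; the value is #|G| when v is not reachable from u. *)
Definition gdist (u v : G) : nat :=
  find (fun n => walk n u v) (iota 0 #|G|).

Definition distance_regular :=
  connected_graph /\
  exists c : nat -> nat -> nat -> nat, forall (u v : G) (i j : nat),
    #|[set w | (gdist u w == i) && (gdist v w == j)]%SET| = c i j (gdist u v).

Definition diameter : nat := (\max_(u : G) \max_(v : G) gdist u v)%N.

Definition strongly_regular := distance_regular /\ diameter = 2%N.

Definition arcType := {p : G * G | adj p.1 p.2}.

Definition arc_tail (p : arcType) : G := (val p).1.
Definition arc_head (p : arcType) : G := (val p).2.

End Graph.

(* Functions on the arcs of G are column vectors of height #|{: arcType G}|; the
   coordinate i is the value at the arc enum_val i, and matrices act by left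
   multiplication. *)
Section Walk.
Variables (R : realType) (G : sgraph) (k : nat) (a : G).

Local Notation N := #|{: arcType G}|.

Definition swapmx : 'M[R[i]]_N := \matrix_(i, j)
  ((arc_tail (enum_val j) == arc_head (enum_val i)) &&
   (arc_head (enum_val j) == arc_tail (enum_val i)))%:R.

Definition coinmx : 'M[R[i]]_N := \matrix_(i, j)
  (2 / k%:R * (arc_tail (enum_val i) == arc_tail (enum_val j))%:R - (i == j)%:R).

Definition oraclemx : 'M[R[i]]_N := diag_mx
  (\row_i (if arc_tail (enum_val i) == a then -1 else 1)).

Definition transmx : 'M[R[i]]_N := swapmx *m coinmx *m oraclemx.

Definition init_state : 'cV[R[i]]_N := const_mx (sqrtC (#|G| * k)%N%:R)^-1.

End Walk.

(* The library's eigenspaces and orthogonal projections act on row vectors, hence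
   the transpositions: for a column x, eigenproj A l *m x is the projection of x,
   orthogonal for the Hermitian inner product, onto the x with A *m x = l *: x. *)
Definition eigenproj (R : realType) (n : nat) (A : 'M[R[i]]_n) (l : R[i]) :
    'M[R[i]]_n :=
  (proj_ortho (eigenspace A^T l))^T.

(* The sum over l ranges over the finite set of distinct eigenvalues; Normc.normc
   is the modulus with values in R rather than R[i]. *)
Definition avg_search_prob (R : realType) (G : sgraph) (k : nat) (a : G) : R :=
  let U := transmx R k a in
  \sum_(i < #|{: arcType G}| | arc_tail (enum_val i) == a)
    \sum_(l \in [set l : R[i] | eigenvalue U^T l])
      Normc.normc ((eigenproj U l *m init_state R G k) i 0) ^+ 2.

(* Main.v *)
Require Import Defs.
From HB Require Import structures.
From mathcomp Require Import all_boot all_order all_algebra.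
From mathcomp Require Import spectral complex.
From mathcomp Require Import all_classical all_reals all_analysis.
From mathcomp Require Import ring lra zify.

(** Write f for a function on arcs and Rf for its reversal. The uniform initial
state x0, the marked vertex and the walk only see the distance from a, so the
dynamics is governed by the quotient of the graph with a deleted. Let phi be a
function on vertices that vanishes at a, is constant on each of the two other
distance classes, and satisfies sum_(w ~ v) phi w = k c phi v for v <> a.
Putting f(u, v) = phi u, one finds U f = Rf and U (Rf) = 2 c Rf - f, hence for
z = c + i sqrt(1 - c^2) the combinations Rf - z^* f and Rf - z f are
eigenvectors for z and z^*.

The 2 x 2 quotient has eigenvalues c1, c2 with functions phi1, phi2 that can be
scaled so that phi1 + phi2 is the indicator of the vertices other than a. Then
1 is the sum of (f_i + Rf_i) / (1 + c_i), i = 1, 2, and of a vector that U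
negates. Thus x0 is a sum of at most five eigenvectors with distinct
eigenvalues. As U is unitary, these are exactly the nonzero projections F_r x0
([sum_eigenproj_sqnorm]), and the average search probability is a closed form
in the c_i and the values al_i of phi_i on the neighbours of a
([avg_search_prob_modes]).

For a strongly regular graph with n vertices, parameters k, lam, mu and
b = k - 1 - lam, one has c_i = 1 - y_i / k where y1 < 1 < y2 are the roots of
y^2 - (b + mu + 1) y + mu. The value is p^2 r + q^2 s + (1 - p - q)^2 / n with
p = al1 / (1 + c1), q = al2 / (1 + c2), r = k / (y1 n) and s = k / (y2 n).
Two neighbours of a vertex v at mutual distance 2 show that
k + 1 <= 2 b + mu, so y2 is of order k: this makes al2 = O(1/k), p tend to 1/2
and r tend to 1. The delicate point is that c2 may be close to -1, as in
complete bipartite graphs; nevertheless 1 + c2 >= 1 / (2 k)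
([smallest_angle_bound]), which keeps q bounded, while s and 1 / n are
O(1/k). Hence the value is 1/4 + O(1/k), uniformly over all graphs of valency
k ([srg_avg_search_prob]). *)

Set Implicit Arguments.
Unset Strict Implicit.
Unset Printing Implicit Defensive.

Import Order.TTheory GRing.Theory Num.Theory.
Import numFieldNormedType.Exports.

Local Open Scope classical_set_scope.
Local Open Scope ring_scope.

(** * Eigenprojections of a unitary matrix *)

Section EigenProj.
Variables (R : realType) (n : nat) (A : 'M[R[i]]_n).
Local Open Scope sesquilinear_scope.

Lemma eigenproj_id (l : R[i]) (v : 'cV_n) :
  A *m v = l *: v -> eigenproj A l *m v = v.
Proof.
move=> Av; apply: trmx_inj; rewrite trmx_mul trmxK.
by rewrite proj_ortho_id //; apply/eigenspaceP; rewrite -trmx_mul Av linearZ.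
Qed.

(** Row vectors are used because the library's eigenspaces consist of rows. A
unitary matrix preserves the inner product of v and w but multiplies it by
m l^*, while l l^* = 1 unless w = 0. *)
Lemma unitary_eigenvectors_orth (l m : R[i]) (w v : 'rV_n) :
  A^T \is unitarymx -> w *m A^T = l *: w -> v *m A^T = m *: v ->
  l != m -> v *m w^t* = 0.
Proof.
move=> /unitarymxP Au wA vA lm.
have key (p q : R[i]) (x y : 'rV_n) : x *m A^T = p *: x -> y *m A^T = q *: y ->
    dotmx x y = (p * q^*) * dotmx x y.
  move=> xA yA; rewrite !dotmxE.
  have {1}-> : x *m y^t* = (x *m A^T) *m (y *m A^T)^t*.
    by rewrite [(y *m _)^T]trmx_mul map_mxM mulmxA -(mulmxA x) Au mulmx1.
  by rewrite xA yA [(_ *: y)^T]linearZ map_mxZ -scalemxAl -scalemxAr scalerA mxE.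
have [->|w0] := eqVneq w 0; first by rewrite trmx0 map_mx0 mulmx0.
have ww : dotmx w w != 0 by rewrite dnorm_eq0.
have ll : l * l^* = 1 by apply: (mulIf ww); rewrite mul1r -key.
have [vw|vw] := eqVneq (dotmx v w) 0.
  by apply/matrixP=> i j; rewrite !ord1 -dotmxE vw mxE.
have ml : m * l^* = 1 by apply: (mulIf vw); rewrite mul1r -key.
have l0 : l^* != 0.
  by apply/eqP=> l0; move: ll; rewrite l0 mulr0 => /eqP; rewrite eq_sym oner_eq0.
by case/eqP: lm; apply: (mulIf l0); rewrite ll.
Qed.

Lemma eigenproj_orth (l m : R[i]) (v : 'cV_n) :
  A^T \is unitarymx -> A *m v = m *: v -> l != m -> eigenproj A l *m v = 0.
Proof.
move=> Au Av lm; apply: trmx_inj; rewrite trmx_mul trmxK trmx0.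
rewrite proj_ortho_0 //.
have vA : v^T *m A^T = m *: v^T by rewrite -trmx_mul Av linearZ.
set E := eigenspace _ _; apply/orthomx1P/matrixP => i j; rewrite ord1.
have /(unitary_eigenvectors_orth Au) : row j E *m A^T = l *: row j E.
  by apply/eigenspaceP; rewrite row_sub.
move=> /(_ m v^T vA lm) /matrixP /(_ 0 0); rewrite [in X in _ = X]mxE => rE0.
rewrite [RHS]mxE -[RHS]rE0 [LHS]mxE [RHS]mxE.
by apply: eq_bigr => s _; rewrite !mxE.
Qed.

(** The decomposition of x into eigenvectors with distinct eigenvalues is unique,
so the projections of x can be read off from any such decomposition. Some of
the vectors may be zero, in which case their label need not be an
eigenvalue. *)
Lemma sum_eigenproj_sqnorm (r : seq (R[i] * 'cV[R[i]]_n)) (x : 'cV_n) i :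
  A^T \is unitarymx -> uniq [seq p.1 | p <- r] ->
  (forall p, p \in r -> A *m p.2 = p.1 *: p.2) -> x = \sum_(p <- r) p.2 ->
  \sum_(l \in [set l : R[i] | eigenvalue A^T l])
     Normc.normc ((eigenproj A l *m x) i 0) ^+ 2 =
  \sum_(p <- r) Normc.normc (p.2 i 0) ^+ 2.
Proof.
move=> Au ur Ar ->.
set F := fun l => Normc.normc ((eigenproj A l *m _) i 0) ^+ 2.
have F0 l : eigenproj A l *m (\sum_(p <- r) p.2) = 0 -> F l = 0.
  by move=> h; rewrite /F h mxE Normc.normc0 expr0n.
(* Both index sets are extended by zero terms to the set of all complex numbers:
   off the spectrum the projection is 0, and off the labels of r it kills x. *)
rewrite (fsbig_widen _ [set: R[i]])//=; last first.
  move=> l [_ /= /negP]; rewrite /eigenvalue negbK => /eqP l0; apply: F0.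
  apply: trmx_inj; rewrite trmx_mul trmxK trmx0 /proj_ortho l0.
  by apply/eqP; rewrite -submx0 -[X in (_ <= X)%MS](genmx0 _ n n) proj_mx_sub.
rewrite -(fsbig_widen [set` [seq p.1 | p <- r]])//=; last first.
  move=> l [_ /= lr]; apply: F0; rewrite mulmx_sumr big1_seq // => p /= pr.
  rewrite (eigenproj_orth _ (Ar p pr)) //.
  by apply/eqP=> lp; apply: lr; rewrite lp; apply: map_f.
rewrite -fsbig_seq // big_map; apply: eq_big_seq => p pr.
rewrite /F mulmx_sumr (big_rem p pr) /= (eigenproj_id (Ar p pr)).
rewrite big1_seq ?addr0 // => q /= qr.
have /andP[pr' _] : uniq [seq q.1 | q <- p :: rem p r].
  by rewrite -(perm_uniq (perm_map _ (perm_to_rem pr))).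
rewrite (eigenproj_orth _ (Ar q (mem_rem qr))) //.
by apply: contra pr' => /eqP ->; apply: map_f.
Qed.
End EigenProj.

(** * The walk acting on functions of arcs *)

Section ArcMatrices.
Variables (R : realType) (G : sgraph) (k : nat) (a : G).
Local Notation C := R[i].
Local Notation N := #|{: arcType G}|.
Local Open Scope sesquilinear_scope.

(** Functions of arcs are given as functions of all ordered pairs of vertices, so
that formulas can be written down without proofs of adjacency. *)
Definition arc_vec (F : G -> G -> C) : 'cV[C]_N :=
  \col_i F (arc_tail (enum_val i)) (arc_head (enum_val i)).

Lemma eq_arc_vec (F F' : G -> G -> C) :
  (forall u v, adj u v -> F u v = F' u v) -> arc_vec F = arc_vec F'.
Proof.
move=> FF'; apply/matrixP=> i j; rewrite !mxE; apply: FF'.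
exact: (valP (enum_val i)).
Qed.

Lemma arc_vec_surj (x : 'cV[C]_N) : exists F, x = arc_vec F.
Proof.
exists (fun u v => if insub (u, v) is Some p then x (enum_rank (p : arcType G)) 0
                   else 0).
apply/matrixP=> i j; rewrite !mxE ord1 /arc_tail /arc_head -surjective_pairing.
by rewrite valK enum_valK.
Qed.

Lemma sum_arcs (V : nmodType) (F : G -> G -> V) :
  \sum_(i < N) F (arc_tail (enum_val i)) (arc_head (enum_val i)) =
  \sum_u \sum_(v | adj u v) F u v.
Proof.
rewrite -(big_enum_val (fun p : arcType G => F (arc_tail p) (arc_head p))) /=.
rewrite pair_big_dep /= [RHS](big_sub (fun p : G * G => adj p.1 p.2)).
exact: eq_bigl.
Qed.

Lemma arc_eq (i j : 'I_N) :
  (i == j) = (arc_tail (enum_val i) == arc_tail (enum_val j)) &&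
             (arc_head (enum_val i) == arc_head (enum_val j)).
Proof.
rewrite -(inj_eq enum_val_inj) -val_eqE; exact: xpair_eqE.
Qed.

Lemma sum_arc_delta (x y : G) (F : G -> G -> C) : adj x y ->
  \sum_u \sum_(v | adj u v) ((u == x) && (v == y))%:R * F u v = F x y.
Proof.
move=> xy; rewrite (bigD1 x) //= (bigD1 y) //= !eqxx mul1r.
rewrite big1 ?addr0 => [|v /andP[_ /negPf->]]; last by rewrite mul0r.
rewrite big1 ?addr0 // => u /negPf ux.
by rewrite big1 // => v _; rewrite ux mul0r.
Qed.

Lemma swapmx_arc_vec (F : G -> G -> C) :
  swapmx R G *m arc_vec F = arc_vec (fun u v => F v u).
Proof.
apply/matrixP=> i j; rewrite !mxE.
under eq_bigr do rewrite !mxE.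
rewrite (sum_arcs (fun u v => ((u == arc_head (enum_val i)) &&
   (v == arc_tail (enum_val i)))%:R * F u v)).
by rewrite sum_arc_delta // adj_sym; exact: (valP (enum_val i)).
Qed.

Lemma coinmx_arc_vec (F : G -> G -> C) :
  coinmx R G k *m arc_vec F =
  arc_vec (fun u v => 2 / k%:R * (\sum_(w | adj u w) F u w) - F u v).
Proof.
apply/matrixP=> i j; rewrite !mxE.
under eq_bigr do rewrite !mxE arc_eq.
set x := arc_tail _; set y := arc_head _.
have xy : adj x y := valP (enum_val i).
rewrite (sum_arcs (fun u v => (2 / k%:R * (x == u)%:R -
   ((x == u) && (y == v))%:R) * F u v)).
under eq_bigr do under eq_bigr do rewrite mulrBl eq_sym [y == _]eq_sym -mulrA.
under eq_bigr do rewrite sumrB -mulr_sumr.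
rewrite sumrB sum_arc_delta //; congr (_ - _).
rewrite (bigD1 x) //= eqxx mulr1 [X in _ + X]big1 ?addr0 // => u /negPf ->.
by rewrite !mulr0 mul0r.
Qed.

Lemma oraclemx_arc_vec (F : G -> G -> C) :
  oraclemx R a *m arc_vec F = arc_vec (fun u v => (-1) ^+ (u == a) * F u v).
Proof.
apply/matrixP=> i j; rewrite mul_diag_mx !mxE.
by case: eqP => _; rewrite ?expr0 ?expr1.
Qed.

Lemma transmx_arc_vec (F : G -> G -> C) :
  transmx R k a *m arc_vec F = arc_vec (fun u v =>
    (-1) ^+ (v == a) * (2 / k%:R * (\sum_(w | adj v w) F v w) - F v u)).
Proof.
rewrite /transmx -!mulmxA oraclemx_arc_vec coinmx_arc_vec swapmx_arc_vec.
by apply: eq_arc_vec => u v _; rewrite -mulr_sumr mulrBr mulrCA.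
Qed.

(** Swap, coin and oracle are Hermitian involutions; checking the involution on
functions of arcs avoids matrix products. *)
Lemma involution_unitary (M : 'M[C]_N) :
  M^t* = M -> (forall F, M *m (M *m arc_vec F) = arc_vec F) ->
  M \is unitarymx.
Proof.
move=> MM Minv; apply/unitarymxP; rewrite MM; apply/trmx_inj/row_matrixP => j.
have [F FE] := arc_vec_surj (delta_mx j 0).
by rewrite -!tr_col !colE -mulmxA FE Minv mul1mx.
Qed.

Lemma transmx_unitary : (0 < k)%N -> k_regular G k -> transmx R k a \is unitarymx.
Proof.
move=> k0 kreg; rewrite /transmx !mul_unitarymx //; apply: involution_unitary.
- apply/matrixP=> i j; rewrite !mxE conjC_nat andbC.
  by congr (_ && _)%:R; rewrite eq_sym.
- by move=> F; rewrite !swapmx_arc_vec.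
- apply/matrixP=> i j; rewrite !mxE rmorphB rmorphM /= !conjC_nat.
  rewrite eq_sym [j == i]eq_sym; congr (_ * _ - _).
  by rewrite fmorph_div /= !conjC_nat.
- move=> F; rewrite !coinmx_arc_vec; apply: eq_arc_vec => u v _.
  rewrite sumrB sumr_const -mulr_natr.
  have -> : #|[pred w | adj u w]| = k by rewrite -[RHS](kreg u) cardsE.
  have : k%:R != 0 :> C by rewrite pnatr_eq0 -lt0n.
  move=> kC; field. exact: kC.
- apply/matrixP=> i j; rewrite !mxE rmorphMn /= [j == i]eq_sym.
  case: (eqVneq i j) => [->|_]; last by rewrite !mulr0n.
  by case: ifP => _; rewrite ?rmorphN rmorph1.
- move=> F; rewrite !oraclemx_arc_vec; apply: eq_arc_vec => u v _.
  by rewrite mulrA -signr_addb addbb mul1r.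
Qed.

End ArcMatrices.

(** * Eigenvectors built from functions of the vertices *)

(** An eigenfunction, for the eigenvalue k c, of the graph with the vertex a
deleted, extended by 0 at a. The last clause says that phi is constant on the
neighbours of a. *)
Definition search_mode (F : nzRingType) (G : sgraph) (k : nat) (a : G)
    (c : F) (phi : G -> F) :=
  [/\ phi a = 0,
      forall v, v != a -> \sum_(w | adj v w) phi w = k%:R * c * phi v &
      forall u, adj a u -> \sum_(w | adj a w) phi w = k%:R * phi u].

Section Decomposition.
Variables (R : realType) (G : sgraph) (k : nat) (a : G).
Hypotheses (k_gt0 : (0 < k)%N) (k_reg : k_regular G k).
Local Notation C := R[i].
Local Notation U := (transmx R k a).

Lemma sum_adj_const (v : G) (x : C) : \sum_(w | adj v w) x = k%:R * x.
Proof.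
by rewrite mulr_natl -[in RHS](k_reg v) cardsE sumr_const.
Qed.

Let kC : k%:R != 0 :> C. Proof. by rewrite pnatr_eq0 -lt0n. Qed.

Lemma transmx_const1 :
  U *m arc_vec (fun _ _ => 1) = arc_vec (fun u v : G => (-1) ^+ (v == a)) :> 'cV[C]_ _.
Proof.
rewrite transmx_arc_vec; apply: eq_arc_vec => u v _.
by rewrite sum_adj_const mulr1 divfK //; ring.
Qed.

(** The sign of the oracle is invisible here since phi vanishes at a, and the coin
fixes a function of the tail: only the swap acts. *)
Lemma transmx_mode_tail (phi : G -> C) : phi a = 0 ->
  U *m arc_vec (fun u v => phi u) = arc_vec (fun u v => phi v).
Proof.
move=> phia; rewrite transmx_arc_vec; apply: eq_arc_vec => u v _.
rewrite sum_adj_const mulrA divfK // mulr2n mulrDl mul1r addrK.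
by case: eqP => [->|_]; rewrite ?phia ?mulr0 ?mul1r.
Qed.

(** At arcs with head a the sign of the oracle and the constancy of phi on the
neighbours of a together produce the same formula as elsewhere. *)
Lemma transmx_mode_head (c : C) (phi : G -> C) : search_mode k a c phi ->
  U *m arc_vec (fun u v => phi v) = arc_vec (fun u v => 2 * c * phi v - phi u).
Proof.
case=> phia phiv phi1; rewrite transmx_arc_vec; apply: eq_arc_vec => u v uv.
have [va|va] := eqVneq v a.
  rewrite va phia (phi1 u) 1?adj_sym -?va //.
  by rewrite mulrA divfK // mulr0 sub0r expr1 mulN1r; ring.
by rewrite mul1r phiv //; field.
Qed.

(** On the span of the tail and head lifts of phi the walk is the companion matrix
of X^2 - 2 c X + 1, whose roots are z and z'. *)
Lemma transmx_mode_eigen (c z z' : C) (phi : G -> C) : search_mode k a c phi ->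
  z + z' = 2 * c -> z * z' = 1 ->
  U *m arc_vec (fun u v => phi v - z' * phi u) =
    z *: arc_vec (fun u v => phi v - z' * phi u).
Proof.
move=> phiP zc zz; have [phia _ _] := phiP.
have -> : arc_vec (fun u v => phi v - z' * phi u) =
    arc_vec (fun u v => phi v) - z' *: arc_vec (fun u v => phi u).
  by apply/matrixP=> i j; rewrite !mxE.
rewrite mulmxBr -scalemxAr (transmx_mode_head phiP) (transmx_mode_tail phia).
by apply/matrixP=> i j; rewrite !mxE -zc mulrBr mulrA zz; ring.
Qed.

(** What is left of the constant function after removing the part along the modes
is symmetric under reversal and has zero sum over the arcs leaving any vertex
other than a, so the coin negates it there. *)
Lemma transmx_residual_eigen (c1 c2 : C) (phi1 phi2 : G -> C) :
  search_mode k a c1 phi1 -> search_mode k a c2 phi2 ->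
  (forall v, phi1 v + phi2 v = (v != a)%:R) -> 1 + c1 != 0 -> 1 + c2 != 0 ->
  let y := arc_vec (fun u v => 1 - (phi1 u + phi1 v) / (1 + c1)
                                 - (phi2 u + phi2 v) / (1 + c2)) in
  U *m y = (-1) *: y.
Proof.
move=> phi1P phi2P phiD c1_neq c2_neq y.
have [phi1a _ _] := phi1P; have [phi2a _ _] := phi2P.
have -> : y = arc_vec (fun u v => 1)
    - (1 + c1)^-1 *: (arc_vec (fun u v => phi1 u) + arc_vec (fun u v => phi1 v))
    - (1 + c2)^-1 *: (arc_vec (fun u v => phi2 u) + arc_vec (fun u v => phi2 v)).
  by apply/matrixP=> i j; rewrite !mxE; field; rewrite c1_neq c2_neq.
rewrite !mulmxBr -!scalemxAr !mulmxDr transmx_const1.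
rewrite (transmx_mode_head phi1P) (transmx_mode_tail phi1a).
rewrite (transmx_mode_head phi2P) (transmx_mode_tail phi2a).
apply/matrixP=> i j; rewrite !mxE; set u := arc_tail _; set v := arc_head _.
have -> : (-1) ^+ (v == a) = 2 * (phi1 v + phi2 v) - 1 :> C.
  by rewrite phiD; case: eqP => _ /=; ring.
by field; rewrite c1_neq c2_neq.
Qed.

End Decomposition.

Lemma search_mode_rmorph (F F' : nzRingType) (f : {rmorphism F -> F'})
    (G : sgraph) (k : nat) (a : G) (c : F) (phi : G -> F) :
  search_mode k a c phi -> search_mode k a (f c) (f \o phi).
Proof.
case=> phia phiv phi1; split => [|v va|u au] /=; first by rewrite phia rmorph0.
  by rewrite -rmorph_sum phiv // !rmorphM rmorph_nat.
by rewrite -rmorph_sum (phi1 u) // rmorphM rmorph_nat.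
Qed.

(** * The eigenphases *)

Section Phase.
Variable R : realType.
Local Open Scope complex_scope.

Definition phase (c : R) : R[i] := Complex c (Num.sqrt (1 - c ^+ 2)).

Lemma sqr_normcE (z : R[i]) : ((Normc.normc z ^+ 2)%:C = z * z^*)%C.
Proof.
case: z => x y; rewrite /Normc.normc sqr_sqrtr ?addr_ge0 ?sqr_ge0 //.
by apply/eqP; rewrite eq_complex /=; apply/andP; split; apply/eqP; ring.
Qed.

Lemma sqr_normcM (x y : R[i]) :
  Normc.normc (x * y) ^+ 2 = Normc.normc x ^+ 2 * Normc.normc y ^+ 2.
Proof. by rewrite Normc.normcM exprMn. Qed.

Lemma sqr_normc_real (x : R) : Normc.normc x%:C ^+ 2 = x ^+ 2.
Proof. by rewrite /Normc.normc /= expr0n addr0 sqrtr_sqr real_normK ?num_real. Qed.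

Variable c : R.
Hypothesis c_itv : -1 < c < 1.

Let s_gt0 : 0 < Num.sqrt (1 - c ^+ 2).
Proof. by case/andP: c_itv => ? ?; rewrite sqrtr_gt0; nra. Qed.

Let s2 : Num.sqrt (1 - c ^+ 2) ^+ 2 = 1 - c ^+ 2.
Proof. by case/andP: c_itv => ? ?; rewrite sqr_sqrtr //; nra. Qed.

Lemma phaseD : phase c + (phase c)^* = 2 * c%:C.
Proof.
by apply/eqP; rewrite eq_complex /=; apply/andP; split; apply/eqP; ring.
Qed.

Lemma phaseM : phase c * (phase c)^* = 1.
Proof.
rewrite -sqr_normcE /phase /Normc.normc sqr_sqrtr ?addr_ge0 ?sqr_ge0 //.
by rewrite s2 addrC subrK.
Qed.

Lemma phase_neq_conj : phase c != (phase c)^*.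
Proof.
rewrite eq_complex negb_and /=; apply/orP; right.
by apply/eqP => h; move: s_gt0; rewrite lt_neqAle => /andP[/eqP]; lra.
Qed.

(** Equal to (1 + z) / (z - z^* ) for z = phase c: the coefficient A for which
A (Rf - z^* f) + A^* (Rf - z f) = Rf + f. *)
Definition phase_weight : R[i] :=
  Complex (1 / 2) (- (1 + c) / (2 * Num.sqrt (1 - c ^+ 2))).

Lemma phase_weightD : phase_weight + phase_weight^* = 1.
Proof.
apply/eqP; rewrite eq_complex /= subrr eqxx andbT.
by apply/eqP; field.
Qed.

Lemma phase_weight_comb :
  phase_weight * (phase c)^* + phase_weight^* * phase c = -1.
Proof.
have s0 := lt0r_neq0 s_gt0.
by apply/eqP; rewrite eq_complex /=; apply/andP; split; apply/eqP; field.
Qed.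

Lemma sqr_normc_phase_weight :
  Normc.normc phase_weight ^+ 2 = (2 * (1 - c))^-1.
Proof.
rewrite /Normc.normc sqr_sqrtr ?addr_ge0 ?sqr_ge0 //.
rewrite [(- (1 + c) / _) ^+ 2]expr_div_n [(2 * _) ^+ 2]exprMn s2; case/andP: c_itv => c1 c2.
by field; rewrite subr_eq0 gt_eqF //= -[1 - c ^+ 2]/(1 - c ^+ 2) gt_eqF //; nra.
Qed.

End Phase.

(** * The search probability in closed form *)

Section SearchProbability.
Variables (R : realType) (G : sgraph) (k : nat) (a : G).
Hypotheses (k_gt0 : (0 < k)%N) (k_reg : k_regular G k).
Local Open Scope complex_scope.
Local Arguments conjc : simpl never.
Local Notation U := (transmx R k a).

(** The two components of (f + Rf) / (1 + c) along the eigenvectors of a mode, for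
(w, z) equal to (phase_weight c, (phase c)^* ) and to its conjugate. *)
Definition phase_part (c : R) (w z : R[i]) (phi : G -> R) :
    'cV[R[i]]_#|{: arcType G}| :=
  ((1 + c)^-1)%:C * w *: arc_vec (fun u v => (phi v)%:C - z * (phi u)%:C).

Lemma phase_part_eigen (c : R) (w z z' : R[i]) (phi : G -> R) :
  search_mode k a c phi -> z + z' = 2 * c%:C -> z * z' = 1 ->
  U *m phase_part c w z' phi = z *: phase_part c w z' phi.
Proof.
move=> /(search_mode_rmorph (real_complex R)) phiP zD zM.
by rewrite -scalemxAr (transmx_mode_eigen k_gt0 k_reg phiP zD zM) !scalerA mulrC.
Qed.

Lemma sqr_normc_phase_part (c : R) (w z : R[i]) (phi : G -> R) i :
  -1 < c < 1 -> Normc.normc w ^+ 2 = (2 * (1 - c))^-1 -> phi a = 0 ->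
  arc_tail (enum_val i) = a ->
  Normc.normc (phase_part c w z phi i 0) ^+ 2 =
  phi (arc_head (enum_val i)) ^+ 2 / ((1 - c) * (1 + c) ^+ 2) / 2.
Proof.
move=> /andP[c1 c2] wE phia ia; rewrite !mxE ia phia mulr0 subr0.
rewrite !sqr_normcM !sqr_normc_real wE.
by field; rewrite !gt_eqF //; lra.
Qed.

Lemma phase_part_sum (c : R) (phi : G -> R) : -1 < c < 1 ->
  phase_part c (phase_weight c) (phase c)^* phi +
  phase_part c (phase_weight c)^* (phase c) phi =
  arc_vec (fun u v => ((phi u)%:C + (phi v)%:C) / (1 + c%:C)).
Proof.
move=> c_itv; apply/matrixP=> i j; rewrite !mxE.
set x := (phi _)%:C; set y := (phi _)%:C.
have -> : (1 + c%:C)^-1 = ((1 + c)^-1)%:C.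
  by rewrite fmorphV rmorphD rmorph1.
rewrite -!mulrA -mulrDr mulrC; congr (_ * _).
transitivity ((phase_weight c + (phase_weight c)^*) * x -
  (phase_weight c * (phase c)^* + (phase_weight c)^* * phase c) * y).
  by ring.
rewrite phase_weightD phase_weight_comb //; ring.
Qed.

Lemma sqr_normc_inv_sqrtC_nat (n : nat) :
  Normc.normc ((sqrtC (n%:R : R[i]))^-1) ^+ 2 = (n%:R)^-1.
Proof.
rewrite Normc.normcV exprVn expr2 -Normc.normcM -expr2 sqrtCK.
have -> : n%:R = (n%:R)%:C :> R[i] by rewrite rmorph_nat.
by rewrite /Normc.normc /= expr0n addr0 sqrtr_sqr ger0_norm.
Qed.

(** The constant function is the sum of five eigenvectors: two for each mode and
the residual one, for the eigenvalue -1. At an arc leaving a, both components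
of the mode phi have squared modulus
phi v ^ 2 / (2 (1 - c) (1 + c) ^ 2). *)
Lemma avg_search_prob_modes (c1 c2 : R) (phi1 phi2 : G -> R) :
  -1 < c1 < 1 -> -1 < c2 < 1 -> c1 != c2 ->
  search_mode k a c1 phi1 -> search_mode k a c2 phi2 ->
  (forall v, phi1 v + phi2 v = (v != a)%:R) ->
  avg_search_prob R k a = \sum_(v | adj a v)
    (phi1 v ^+ 2 / ((1 - c1) * (1 + c1) ^+ 2)
   + phi2 v ^+ 2 / ((1 - c2) * (1 + c2) ^+ 2)
   + (1 - phi1 v / (1 + c1) - phi2 v / (1 + c2)) ^+ 2) / (#|G| * k)%:R.
Proof.
move=> c1_itv c2_itv c12 phi1P phi2P phiD.
have phi1C := search_mode_rmorph (real_complex R) phi1P.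
have phi2C := search_mode_rmorph (real_complex R) phi2P.
have [[phi1a _ _] [phi2a _ _]] := (phi1P, phi2P).
pose kappa := (sqrtC ((#|G| * k)%N%:R : R[i]))^-1.
pose y : 'cV_#|{: arcType G}| :=
  arc_vec (fun u v => 1 - ((phi1 u)%:C + (phi1 v)%:C) / (1 + c1%:C)
                        - ((phi2 u)%:C + (phi2 v)%:C) / (1 + c2%:C)).
have yP : U *m y = (-1) *: y.
  apply: (transmx_residual_eigen k_gt0 k_reg phi1C phi2C).
  - by move=> v; rewrite /= -rmorphD phiD rmorph_nat.
  - by rewrite -(rmorph1 (real_complex R)) -rmorphD fmorph_eq0 gt_eqF //; lra.
  - by rewrite -(rmorph1 (real_complex R)) -rmorphD fmorph_eq0 gt_eqF //; lra.
pose e1 := phase_part c1 (phase_weight c1) (phase c1)^*%C phi1.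
pose e1' := phase_part c1 (phase_weight c1)^*%C (phase c1) phi1.
pose e2 := phase_part c2 (phase_weight c2) (phase c2)^*%C phi2.
pose e2' := phase_part c2 (phase_weight c2)^*%C (phase c2) phi2.
have e_sum : y + (e1 + e1') + (e2 + e2') = arc_vec (fun _ _ => 1).
  rewrite !phase_part_sum //; apply/matrixP=> i j; rewrite !mxE; ring.
have e1P : U *m e1 = phase c1 *: e1.
  by apply: phase_part_eigen => //; [exact: phaseD|exact: phaseM].
have e1'P : U *m e1' = (phase c1)^*%C *: e1'.
  apply: phase_part_eigen => //; first by rewrite addrC phaseD.
  by rewrite mulrC phaseM.
have e2P : U *m e2 = phase c2 *: e2.
  by apply: phase_part_eigen => //; [exact: phaseD|exact: phaseM].
have e2'P : U *m e2' = (phase c2)^*%C *: e2'.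
  apply: phase_part_eigen => //; first by rewrite addrC phaseD.
  by rewrite mulrC phaseM.
have e_at i : arc_tail (enum_val i) = a ->
    Normc.normc (y i 0) ^+ 2 + Normc.normc (e1 i 0) ^+ 2
    + Normc.normc (e1' i 0) ^+ 2 + Normc.normc (e2 i 0) ^+ 2
    + Normc.normc (e2' i 0) ^+ 2 =
    (let v := arc_head (enum_val i) in
     phi1 v ^+ 2 / ((1 - c1) * (1 + c1) ^+ 2)
     + phi2 v ^+ 2 / ((1 - c2) * (1 + c2) ^+ 2)
     + (1 - phi1 v / (1 + c1) - phi2 v / (1 + c2)) ^+ 2).
  move=> ia /=.
  have conj_weight (c : R) : -1 < c < 1 ->
      Normc.normc (phase_weight c)^*%C ^+ 2 = (2 * (1 - c))^-1.
    move=> c_itv; rewrite -sqr_normc_phase_weight //.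
    by rewrite /Normc.normc /= sqrrN.
  have e1E := sqr_normc_phase_part (phase c1)^*%C c1_itv
    (sqr_normc_phase_weight c1_itv) phi1a ia.
  have e1'E := sqr_normc_phase_part (phase c1) c1_itv
    (conj_weight c1 c1_itv) phi1a ia.
  have e2E := sqr_normc_phase_part (phase c2)^*%C c2_itv
    (sqr_normc_phase_weight c2_itv) phi2a ia.
  have e2'E := sqr_normc_phase_part (phase c2) c2_itv
    (conj_weight c2 c2_itv) phi2a ia.
  rewrite -/e1 in e1E; rewrite -/e1' in e1'E.
  rewrite -/e2 in e2E; rewrite -/e2' in e2'E.
  have yE : y i 0 = (1 - phi1 (arc_head (enum_val i)) / (1 + c1)
                      - phi2 (arc_head (enum_val i)) / (1 + c2))%:C.
    rewrite mxE ia phi1a phi2a !rmorph0 !add0r !rmorphB rmorph1.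
    by rewrite !fmorph_div !rmorphD rmorph1.
  clearbody y e1 e1' e2 e2'.
  rewrite yE sqr_normc_real e1E e1'E e2E e2'E.
  move: (phi1 _ ^+ 2 / _) (phi2 _ ^+ 2 / _) (_ ^+ 2) => x x' t.
  by field.
(* Only the equations collected so far matter; forgetting the definitions keeps
   unification from unfolding them. *)
move: y e1 e1' e2 e2' yP e_sum e1P e1'P e2P e2'P e_at => y e1 e1' e2 e2'.
move=> yP e_sum e1P e1'P e2P e2'P e_at.
pose r := [:: (-1 : R[i], kappa *: y); (phase c1, kappa *: e1);
  ((phase c1)^*%C, kappa *: e1'); (phase c2, kappa *: e2);
  ((phase c2)^*%C, kappa *: e2')].
have r_uniq : uniq [seq p.1 | p <- r].
  have neqN1 (c : R) : -1 < c < 1 -> (-1 == phase c) = false.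
    move=> /andP[h _]; rewrite eq_complex /=; apply/negP => /andP[/eqP h' _].
    by move: h; rewrite -h' ltxx.
  have neqN1' (c : R) : -1 < c < 1 -> (-1 == (phase c)^*%C) = false.
    move=> /andP[h _]; rewrite eq_complex /=; apply/negP => /andP[/eqP h' _].
    by move: h; rewrite -h' ltxx.
  rewrite /r /= !inE !neqN1 // !neqN1' // !(negPf (phase_neq_conj _)) //.
  by rewrite !eq_complex /= !(negPf c12).
have r_eigen p : p \in r -> U *m p.2 = p.1 *: p.2.
  have cs (b c : R[i]) (x : 'cV[R[i]]_#|{: arcType G}|) :
    b *: (c *: x) = c *: (b *: x) by rewrite !scalerA mulrC.
  by rewrite !inE => /or4P[|||/orP[]] /eqP -> /=;
    rewrite -scalemxAr ?yP ?e1P ?e1'P ?e2P ?e2'P.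
have r_sum : init_state R G k = \sum_(p <- r) p.2.
  rewrite !big_cons big_nil addr0 /= -!scalerDr !addrA.
  rewrite !addrA in e_sum; rewrite e_sum.
  by apply/matrixP => i j; rewrite !mxE mulr1.
have U_unitary : U^T \is unitarymx by rewrite trmx_unitary transmx_unitary.
rewrite /avg_search_prob.
transitivity (\sum_(i < #|{: arcType G}| | arc_tail (enum_val i) == a)
   \sum_(p <- r) Normc.normc (p.2 i 0) ^+ 2).
  by apply: eq_bigr => i _; exact: sum_eigenproj_sqnorm.
pose H v := (phi1 v ^+ 2 / ((1 - c1) * (1 + c1) ^+ 2)
   + phi2 v ^+ 2 / ((1 - c2) * (1 + c2) ^+ 2)
   + (1 - phi1 v / (1 + c1) - phi2 v / (1 + c2)) ^+ 2) / (#|G| * k)%:R.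
rewrite [LHS]big_mkcond /=.
transitivity (\sum_(i < #|{: arcType G}|)
   (if arc_tail (enum_val i) == a then H (arc_head (enum_val i)) else 0)).
  apply: eq_bigr => i _; case: eqP => // ia.
  rewrite !big_cons big_nil addr0 /= !mxE !sqr_normcM.
  rewrite -!mulrDr !addrA e_at // sqr_normc_inv_sqrtC_nat mulrC.
  by [].
rewrite (sum_arcs (fun u v => if u == a then H v else 0)).
rewrite (bigD1 a) //= eqxx [X in _ + X]big1 ?addr0 // => u /negPf ->.
by rewrite big1.
Qed.

End SearchProbability.

(** * Parameters of strongly regular graphs *)

Section StronglyRegular.
Variable G : sgraph.

Definition common_nbrs (u v : G) := #|[set w | adj u w && adj v w]%SET|.

Lemma walk0E (u v : G) : walk 0 u v = (u == v).
Proof.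
apply/existsP/eqP => [[p]|->]; first by rewrite (tuple0 p) /= => /eqP.
by exists [tuple]; rewrite /= eqxx.
Qed.

Lemma walk1E (u v : G) : walk 1 u v = adj u v.
Proof.
apply/existsP/idP => [[p]|uv].
  by case/tupleP: p => w p; rewrite (tuple0 p) /= andbT => /andP[uw /eqP <-].
by exists [tuple v]; rewrite /= uv eqxx.
Qed.

Lemma walk2P (u v : G) : walk 2 u v -> exists2 w, adj u w & adj w v.
Proof.
case/existsP => p; case/tupleP: p => w p; case/tupleP: p => x p.
rewrite (tuple0 p) /= andbT => /andP[/andP[uw wx] /eqP <-].
by exists w.
Qed.

(** The distance of two vertices is searched for among the numbers below #|G|, so
in smaller graphs distance 2 would also be the value given to a pair that no
walk joins. *)
Hypothesis G_large : (2 < #|G|)%N.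

Lemma gdist_eq0 (u v : G) : (gdist u v == 0)%N = (u == v).
Proof.
rewrite /gdist; case: #|G| G_large => // n _ /=.
by rewrite walk0E; case: (u == v).
Qed.

Lemma gdist_eq1 (u v : G) : (gdist u v == 1)%N = adj u v.
Proof.
rewrite /gdist; case: #|G| G_large => [//|[//|n]] _ /=.
rewrite walk0E walk1E; have [->|_] := eqVneq u v; first by rewrite adj_irrefl.
by case: (adj u v).
Qed.

Lemma gdist_eq2 (u v : G) : gdist u v = 2%N -> walk 2 u v.
Proof.
move=> uv2; have := @nth_find _ 0%N (fun n => walk n u v) (iota 0 #|G|).
rewrite has_find size_iota -/(gdist u v) uv2 nth_iota // add0n.
exact.
Qed.

Lemma strongly_regular_params : strongly_regular G ->
  [/\ exists lam, forall u v : G, adj u v -> common_nbrs u v = lam,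
      exists mu, forall u v : G, u != v -> ~~ adj u v -> common_nbrs u v = mu &
      exists u v w : G, [/\ adj u v, adj v w, u != w & ~~ adj u w]].
Proof.
move=> [[_ [c cP]] diam2].
have gdist_le2 (u v : G) : (gdist u v <= 2)%N.
  rewrite -diam2 /diameter.
  apply: leq_trans (leq_bigmax u).
  exact: (@leq_bigmax _ (fun v => gdist u v)).
have commonE u v : common_nbrs u v = c 1%N 1%N (gdist u v).
  by rewrite -cP; apply: eq_card => w; rewrite !inE !gdist_eq1.
split.
- exists (c 1%N 1%N 1%N) => u v uv; rewrite commonE.
  by move: uv; rewrite -gdist_eq1 => /eqP ->.
- exists (c 1%N 1%N 2%N) => u v uv1 uv2; rewrite commonE; congr (c _ _ _).
  move: uv1 uv2 (gdist_le2 u v); rewrite -gdist_eq0 -gdist_eq1.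
  by case: (gdist u v) => [|[|[|]]].
have [u [v uv2]] : exists u v : G, gdist u v = 2%N.
  have G_gt0 : (0 < #|G|)%N by apply: leq_trans G_large.
  have [u uE] := @bigop.eq_bigmax G (fun u => \max_(v : G) gdist u v)%N G_gt0.
  have [v vE] := @bigop.eq_bigmax G (fun v => gdist u v)%N G_gt0.
  by exists u, v; rewrite -vE -uE.
have [w uw wv] := walk2P (gdist_eq2 uv2).
exists u, w, v; split=> //; first by rewrite -gdist_eq0 uv2.
by rewrite -gdist_eq1 uv2.
Qed.

End StronglyRegular.

Section Counting.
Variables (G : sgraph) (k lam mu : nat).
Hypothesis k_reg : k_regular G k.
Hypothesis lamP : forall u v : G, adj u v -> common_nbrs u v = lam.
Hypothesis muP : forall u v : G, u != v -> ~~ adj u v -> common_nbrs u v = mu.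

Let nbrs (v : G) := [set w | adj v w]%SET.

Let common_nbrsE (u v : G) : common_nbrs u v = #|nbrs u :&: nbrs v|%N.
Proof. by apply: eq_card => w; rewrite !inE. Qed.

(** In the neighbourhood of v, the lam common neighbours of u and v and the lam
common neighbours of w and v avoid u and w, and at most mu - 1 vertices are
both, since v is one of the mu common neighbours of u and w. The last bound is
what forces k - 1 - lam + mu to grow with k. *)
Lemma srg_param_bounds (u v w : G) :
  adj u v -> adj v w -> u != w -> ~~ adj u w ->
  [/\ (lam.+2 <= k)%N, (0 < mu <= k)%N & (2 * lam + 3 <= k + mu)%N].
Proof.
move=> uv vw uw nuw; have vu : adj v u by rewrite adj_sym.
have wv : adj w v by rewrite adj_sym.
have nwu : ~~ adj w u by rewrite adj_sym.
have lamu : #|nbrs u :&: nbrs v| = lam by rewrite -common_nbrsE lamP.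
have lamw : #|nbrs w :&: nbrs v| = lam by rewrite -common_nbrsE lamP.
have muE : #|nbrs u :&: nbrs w| = mu by rewrite -common_nbrsE muP.
have v_common : v \in nbrs u :&: nbrs w by rewrite !inE uv wv.
have card_rest : (#|nbrs v :\ u :\ w|.+2 = k)%N.
  rewrite -(k_reg v) -/(nbrs v) (cardsD1 u (nbrs v)) inE vu add1n.
  by rewrite (cardsD1 w (nbrs v :\ u)) !inE vw eq_sym uw add1n.
have rest (x : G) : ~~ adj x u -> ~~ adj x w ->
    nbrs x :&: nbrs v \subset nbrs v :\ u :\ w.
  move=> xu xw; apply/fintype.subsetP=> t; rewrite !inE => /andP[xt ->].
  by rewrite andbT; apply/andP; split; apply: contraL xt => /eqP ->.
have restu : nbrs u :&: nbrs v \subset nbrs v :\ u :\ w.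
  by rewrite rest // adj_irrefl.
have restw : nbrs w :&: nbrs v \subset nbrs v :\ u :\ w.
  by rewrite rest // adj_irrefl.
split.
- by rewrite -card_rest !ltnS -lamu subset_leq_card.
- rewrite -{1}muE (cardsD1 v) v_common /= -muE -(k_reg u).
  by rewrite subset_leq_card // finset.subsetIl.
have cap_sub : (nbrs u :&: nbrs v) :&: (nbrs w :&: nbrs v)
    \subset (nbrs u :&: nbrs w) :\ v.
  apply/fintype.subsetP=> t; rewrite !inE => /andP[/andP[-> vt] /andP[-> _]].
  by rewrite !andbT; apply: contraL vt => /eqP ->; rewrite adj_irrefl.
have cup_sub : (nbrs u :&: nbrs v) :|: (nbrs w :&: nbrs v)
    \subset nbrs v :\ u :\ w by rewrite finset.subUset restu restw.
have := cardsUI (nbrs u :&: nbrs v) (nbrs w :&: nbrs v).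
rewrite lamu lamw => cardUI.
have := subset_leq_card cap_sub; have := subset_leq_card cup_sub.
have : (#|(nbrs u :&: nbrs w) :\ v|.+1 = mu)%N.
  by rewrite -muE [RHS](cardsD1 v) v_common.
move: cardUI card_rest; lia.
Qed.

Section Sums.
Variables (F : realFieldType) (a : G).

Lemma sum_nbrs_indic (v : G) : \sum_(w | adj v w) (adj a w)%:R =
  (common_nbrs a v)%:R :> F.
Proof.
rewrite -natr_sum; congr (_%:R); rewrite /common_nbrs -sum1dep_card.
by rewrite big_mkcondr /= big_mkcond [RHS]big_mkcond; apply: eq_bigr => w _;
   case: adj; case: adj.
Qed.

(** The quotient matrix of the distance partition around a, for rows given by any
v: the two indicator functions involved are counted by common neighbours. *)
Lemma sum_nbrs_shell (al be : F) (v : G) :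
  \sum_(w | adj v w)
    (if w == a then 0 else if adj a w then al else be) =
  (common_nbrs a v)%:R * al
  + (k%:R - (common_nbrs a v)%:R - (adj a v)%:R) * be.
Proof.
have -> : (adj a v)%:R = \sum_(w | adj v w) (w == a)%:R :> F.
  rewrite big_mkcond /= (bigD1 a) //= eqxx adj_sym big1 ?addr0.
    by case: adj.
  by move=> w /negPf ->; case: adj.
have -> : k%:R = \sum_(w | adj v w) 1 :> F.
  by rewrite sumr_const -[in LHS](k_reg v) cardsE.
rewrite -sum_nbrs_indic -!sumrB !mulr_suml -big_split /=.
apply: eq_bigr => w _; case: eqP => [->|_]; first by rewrite adj_irrefl /=; ring.
by case: adj => /=; ring.
Qed.

(** Count the walks of length 2 from a: there are k^2 of them, and their number
with a given end depends only on the distance of that end from a. *)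
Lemma srg_card : mu%:R * (#|G|%:R - 1 - k%:R) = k%:R * (k%:R - 1 - lam%:R) :> F.
Proof.
have sum_adj (x : G) : \sum_w (adj x w)%:R = k%:R :> F.
  by rewrite -natr_sum -(k_reg x) -sum1dep_card [in RHS]big_mkcond.
have kk : \sum_w (common_nbrs a w)%:R = k%:R * k%:R :> F.
  under eq_bigr do rewrite -sum_nbrs_indic big_mkcond /=.
  rewrite exchange_big /= -{1}(sum_adj a) mulr_suml; apply: eq_bigr => v _.
  rewrite -(sum_adj v) mulr_sumr; apply: eq_bigr => w _.
  by rewrite adj_sym; case: (adj v w); rewrite ?mulr1 ?mulr0.
have cE (w : G) : (common_nbrs a w)%:R =
    (k%:R - mu%:R) * (w == a)%:R + (lam%:R - mu%:R) * (adj a w)%:R + mu%:R :> F.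
  have [->|wa] := eqVneq w a.
    rewrite adj_irrefl (_ : common_nbrs a a = k) /=; first by ring.
    by rewrite -(k_reg a); apply: eq_card => w'; rewrite !inE andbb.
  case: (boolP (adj a w)) => [/lamP ->|aw] /=; first by ring.
  by rewrite muP 1?eq_sym //; ring.
move: kk; rewrite (eq_bigr _ (fun w _ => cE w)) !big_split /= -!mulr_sumr.
have -> : \sum_w (w == a)%:R = 1 :> F.
  rewrite (bigD1 a) //= eqxx big1 ?addr0 // => w /negPf ->; exact: mulr0n.
rewrite sum_adj sumr_const -mulr_natr => kk.
have -> : #|G| = #|xpredT : pred G| by [].
lra.
Qed.

End Sums.

End Counting.

(** * Estimates *)

Section Estimate.
Variable R : realType.

(** The polynomial y^2 - (b + mu + 1) y + mu takes the value - b at 1. *)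
Lemma srg_roots (b mu : R) : 0 < b -> 0 < mu ->
  exists y1 y2, [/\ y1 + y2 = b + mu + 1, y1 * y2 = mu, 0 < y1 < 1 & 1 < y2].
Proof.
move=> b0 mu0; pose s := Num.sqrt ((b + mu + 1) ^+ 2 - 4 * mu).
have s2 : s ^+ 2 = (b + mu + 1) ^+ 2 - 4 * mu.
  rewrite sqr_sqrtr // (_ : _ - _ = (b + mu - 1) ^+ 2 + 4 * b); last by ring.
  by apply: addr_ge0; [exact: sqr_ge0|lra].
have s0 : 0 <= s by rewrite sqrtr_ge0.
pose y1 := (b + mu + 1 - s) / 2; pose y2 := (b + mu + 1 + s) / 2.
have yD : y1 + y2 = b + mu + 1 by rewrite /y1 /y2; field.
have yM : y1 * y2 = mu by rewrite /y1 /y2; nra.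
have y12 : y1 <= y2 by rewrite /y1 /y2; lra.
have yb : (1 - y1) * (y2 - 1) = b by nra.
have y2_gt0 : 0 < y2 by lra.
have y1_gt0 : 0 < y1 by rewrite -(pmulr_lgt0 _ y2_gt0) yM.
have y1_lt1 : y1 < 1.
  by rewrite ltNge; apply/negP => y1_ge1; nra.
exists y1, y2; rewrite y1_gt0 y1_lt1; split=> //.
by rewrite -subr_gt0 -(pmulr_rgt0 _ (_ : 0 < 1 - y1)) ?yb // subr_gt0.
Qed.

(** With c_i = 1 - y_i / k this says that 1 + c2 >= 1 / (2 k). The product
(2 k - y1) (2 k - y2) equals 2 k t + mu with t = 2 k - b - 1 - mu. For a graph
t = k + lam - mu; it is nonnegative, and mu is close to k when t is small, so
the product is at least k. *)
Lemma smallest_angle_bound (k b mu y1 y2 : R) :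
  1 <= k -> b <= k - 1 -> mu <= k ->
  y1 + y2 = b + mu + 1 -> y1 * y2 = mu -> 0 < y1 -> y1 < 1 ->
  1 / 2 <= 2 * k - y2.
Proof.
move=> k_ge1 b_le mu_le yD yM y1_gt0 y1_lt1.
have wE : (2 * k - y1) * (2 * k - y2) = 2 * k * (2 * k - b - 1 - mu) + mu.
  transitivity (4 * k * k - 2 * k * (y1 + y2) + y1 * y2); first by ring.
  by rewrite yD yM; ring.
have t_ge0 : 0 <= 2 * k - b - 1 - mu by lra.
rewrite leNgt; apply/negP => w_lt.
have: (2 * k - y1) * (2 * k - y2) <= (2 * k - y1) * (1 / 2) by apply: ler_wpM2l; lra.
nra.
Qed.

(** Here e is 1 / k: the first term is 1/4 up to O(e), the other two are O(e). *)
Lemma search_terms_bound (e p q r s t : R) : 0 < e -> e <= 1 / 4 ->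
  1 / 2 - 2 * e <= p -> p <= 1 / 2 + e -> 0 <= q -> q <= 8 ->
  1 - 2 * e <= r -> r <= 1 + 2 * e -> 0 <= s -> s <= 2 * e ->
  0 <= t -> t <= e ->
  `|p ^+ 2 * r + q ^+ 2 * s + (1 - p - q) ^+ 2 * t - 1 / 4| <= 250 * e.
Proof.
move=> e_gt0 e_le p_ge p_le q_ge0 q_le r_ge r_le s_ge0 s_le t_ge0 t_le.
have main : `|p ^+ 2 * r - 1 / 4| <= 50 * e.
  have p2_le : `|p ^+ 2 - 1 / 4| <= 2 * e by rewrite ler_norml; nra.
  have r_le2 : `|r| <= 2 by rewrite ler_norml; lra.
  have r1_le : `|(r - 1) / 4| <= e by rewrite ler_norml; lra.
  have := ler_pM (normr_ge0 _) (normr_ge0 _) p2_le r_le2.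
  have -> : p ^+ 2 * r - 1 / 4 = (p ^+ 2 - 1 / 4) * r + (r - 1) / 4 by field.
  rewrite -normrM => pr_le.
  by apply: (le_trans (ler_normD _ _)); lra.
have q2_le : q ^+ 2 <= 64 by nra.
have q2s_le : q ^+ 2 * s <= 64 * (2 * e) by apply: ler_pM; rewrite ?sqr_ge0.
have pq2_le : (1 - p - q) ^+ 2 <= 64 by nra.
have pq2t_le : (1 - p - q) ^+ 2 * t <= 64 * e by apply: ler_pM; rewrite ?sqr_ge0.
have q2s_ge0 : 0 <= q ^+ 2 * s by rewrite mulr_ge0 ?sqr_ge0.
have pq2t_ge0 : 0 <= (1 - p - q) ^+ 2 * t by rewrite mulr_ge0 ?sqr_ge0.
by move: main; rewrite !ler_norml; lra.
Qed.

Lemma search_value_bound (k b mu n y1 y2 : R)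
    (c1 := 1 - y1 / k) (c2 := 1 - y2 / k)
    (al1 := (y2 - 1) / (y2 - y1)) (al2 := (1 - y1) / (y2 - y1)) :
  4 <= k -> 0 < b -> b <= k - 1 -> 0 < mu -> mu <= k -> k <= 2 * (b + mu) ->
  n * mu = mu + k * (b + mu) ->
  y1 + y2 = b + mu + 1 -> y1 * y2 = mu -> 0 < y1 -> y1 < 1 -> 1 < y2 ->
  `| (al1 ^+ 2 / ((1 - c1) * (1 + c1) ^+ 2)
    + al2 ^+ 2 / ((1 - c2) * (1 + c2) ^+ 2)
    + (1 - al1 / (1 + c1) - al2 / (1 + c2)) ^+ 2) / n - 1 / 4| <= 250 / k.
Proof.
move=> k_ge4 b_gt0 b_le mu_gt0 mu_le bmu nE yD yM y1_gt0 y1_lt1 y2_gt1.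
have k_gt0 : 0 < k by lra.
have w_ge : 1 / 2 <= 2 * k - y2.
  by apply: (@smallest_angle_bound k b mu y1 y2) => //; lra.
(* A variable e for k^-1 lets the linear arithmetic treat it as an atom. *)
have [e e_gt0 ke] : exists2 e, 0 < e & k * e = 1.
  by exists k^-1; rewrite ?invr_gt0 // mulfV // gt_eqF.
have eE : k^-1 = e by apply: (mulfI (lt0r_neq0 k_gt0)); rewrite ke mulfV // gt_eqF.
have e_le : e <= 1 / 4 by nra.
have c1E : 1 + c1 = 2 - y1 * e by rewrite /c1 eE; ring.
have c2E : 1 + c2 = 2 - y2 * e by rewrite /c2 eE; ring.
have y2_gt : b + mu < y2 by lra.
have y2_lt : y2 < b + mu + 1 by lra.
have D_gt0 : 0 < y2 - y1 by lra.
have al2_ge0 : 0 <= al2 by apply: divr_ge0; rewrite ?subr_ge0 ltW // -subr_gt0.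
have al2_le : al2 <= 4 * e.
  by rewrite /al2 ler_pdivrMr //; nra.
have alD : al1 = 1 - al2 by rewrite /al1 /al2; field; rewrite gt_eqF.
have c2_ge : e / 2 <= 1 + c2 by rewrite c2E; nra.
have c2_gt0 : 0 < 1 + c2 by lra.
have y1e_le : y1 * e <= e by rewrite ger_pMl // ltW.
have y1e_gt0 : 0 < y1 * e by rewrite mulr_gt0.
have c1_gt0 : 0 < 1 + c1 by rewrite c1E; lra.
have n_ge : k <= n by rewrite -(ler_pM2r mu_gt0) nE; nra.
have n_gt0 : 0 < n by lra.
have y2_gt0 : 0 < y2 by lra.
have -> : (al1 ^+ 2 / ((1 - c1) * (1 + c1) ^+ 2)
    + al2 ^+ 2 / ((1 - c2) * (1 + c2) ^+ 2)
    + (1 - al1 / (1 + c1) - al2 / (1 + c2)) ^+ 2) / n =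
    (al1 / (1 + c1)) ^+ 2 * (k / (y1 * n))
    + (al2 / (1 + c2)) ^+ 2 * (k / (y2 * n))
    + (1 - al1 / (1 + c1) - al2 / (1 + c2)) ^+ 2 * n^-1.
  have -> : 1 - c1 = y1 / k by rewrite /c1; ring.
  have -> : 1 - c2 = y2 / k by rewrite /c2; ring.
  by field; rewrite !lt0r_neq0.
have m_gt0 : 0 < mu + k * (b + mu) by rewrite addr_gt0 ?mulr_gt0 ?addr_gt0.
have rE : k / (y1 * n) = k * y2 / (mu + k * (b + mu)).
  by rewrite -nE -yM; field; rewrite !lt0r_neq0.
have km_lt : k * (b + mu) < k * y2 < k * (b + mu) + k.
  have -> : k * (b + mu) + k = k * (b + mu + 1) by ring.
  by rewrite !ltr_pM2l // y2_gt.
have k_le_m : k <= k * (b + mu) * (2 * e).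
  have -> : k * (b + mu) * (2 * e) = (k * e) * (2 * (b + mu)) by ring.
  by rewrite ke mul1r.
rewrite eE; apply: search_terms_bound => //.
- by rewrite ler_pdivlMr // alD c1E; clear -al2_le y1e_le y1e_gt0 al2_ge0 e_gt0 e_le; nra.
- by rewrite ler_pdivrMr // alD c1E; clear -al2_le y1e_le y1e_gt0 al2_ge0 e_gt0 e_le; nra.
- exact: divr_ge0 al2_ge0 (ltW c2_gt0).
- by rewrite ler_pdivrMr //; lra.
- rewrite rE ler_pdivlMr //.
  by clear -k_le_m km_lt e_gt0 ke mu_le bmu k_gt0 e_le mu_gt0; nra.
- rewrite rE ler_pdivrMr //.
  by clear -k_le_m km_lt e_gt0 ke mu_le mu_gt0 k_gt0 e_le; nra.
- by rewrite divr_ge0 // ltW // mulr_gt0.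
- rewrite ler_pdivrMr ?mulr_gt0 //.
  have : y2 * (k * e) <= y2 * (n * e) by rewrite !ler_pM2l ?ler_pM2r.
  by rewrite ke; lra.
- by rewrite invr_ge0 ltW.
- by rewrite -eE lef_pV2.
Qed.
End Estimate.

(** * The limit *)

Section SearchOnStronglyRegular.
Variables (R : realType) (G : sgraph) (k lam mu : nat) (a : G).
Hypotheses (k_gt0 : (0 < k)%N) (k_reg : k_regular G k).
Hypothesis lamP : forall u v : G, adj u v -> common_nbrs u v = lam.
Hypothesis muP : forall u v : G, u != v -> ~~ adj u v -> common_nbrs u v = mu.

Definition shell (al be : R) (v : G) : R :=
  if v == a then 0 else if adj a v then al else be.

(** The hypotheses are the two rows of the quotient eigenvalue equation, for the
eigenvalue k - y. *)
Lemma shell_search_mode (y al be : R) :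
  lam%:R * al + (k%:R - lam%:R - 1) * be = (k%:R - y) * al ->
  mu%:R * al + (k%:R - mu%:R) * be = (k%:R - y) * be ->
  search_mode k a (1 - y / k%:R) (shell al be).
Proof.
move=> alE beE.
have kc : k%:R * (1 - y / k%:R) = k%:R - y.
  by field; rewrite pnatr_eq0 -lt0n.
split=> [|v va|u au]; rewrite /shell ?eqxx // ?kc (sum_nbrs_shell k_reg).
  rewrite (negPf va); case: (boolP (adj a v)) => av.
    by rewrite lamP // -alE /=; ring.
  by rewrite muP 1?eq_sym // -beE /=; ring.
rewrite au adj_irrefl (_ : common_nbrs a a = k); last first.
  by rewrite -(k_reg a); apply: eq_card => w; rewrite !inE andbb.
case: eqP au => [->|_ _]; first by rewrite adj_irrefl.
by rewrite /=; ring.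
Qed.

End SearchOnStronglyRegular.

(** The bound depends on the valency alone, which is why the convergence holds for
every sequence of graphs and of marked vertices. *)
Lemma srg_avg_search_prob (R : realType) (G : sgraph) (k : nat) (a : G) :
  strongly_regular G -> k_regular G k -> (4 <= k)%N ->
  `|avg_search_prob R k a - 1 / 4| <= 250 / k%:R.
Proof.
move=> srg k_reg k_ge4.
have k_gt0 : (0 < k)%N by apply: leq_trans k_ge4.
have G_large : (2 < #|G|)%N.
  apply: leq_trans (max_card [set v | adj a v]%SET); rewrite (k_reg a).
  exact: leq_trans k_ge4.
have [[lam lamP] [mu muP] [u [v [w [uv vw uw nuw]]]]] :=
  strongly_regular_params G_large srg.
have [lam_le /andP[mu_gt0 mu_le] lam_mu] :=
  srg_param_bounds k_reg lamP muP uv vw uw nuw.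
have nE := srg_card k_reg lamP muP R a.
pose b : R := k%:R - 1 - lam%:R.
have kR : 4 <= k%:R :> R by rewrite ler_nat.
have lam_ge0 : 0 <= lam%:R :> R by exact: ler0n.
have muR : 0 < mu%:R :> R by rewrite ltr0n.
have muk : mu%:R <= k%:R :> R by rewrite ler_nat.
have bR : 1 <= b.
  move: lam_le; rewrite -(ler_nat R) /b -!natr1; lra.
have bmu : k%:R <= 2 * (b + mu%:R).
  by move: lam_mu; rewrite -(ler_nat R) (natrD _ (2 * lam)%N) natrM (natrD _ k) /b; lra.
have b_gt0 : 0 < b by lra.
have [y1 [y2 [yD yM /andP[y1_gt0 y1_lt1] y2_gt1]]] := srg_roots b_gt0 muR.
have D_neq0 : y2 - y1 != 0 by rewrite gt_eqF // subr_gt0; lra.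
have k_neq0 : k%:R != 0 :> R by rewrite pnatr_eq0 -lt0n.
(* Values of the two modes on the neighbours of a and at distance 2: the
   eigenvectors of the quotient, scaled so that they add up to (1, 1). *)
pose al1 := (y2 - 1) / (y2 - y1); pose be1 := y2 / (y2 - y1).
pose al2 := (1 - y1) / (y2 - y1); pose be2 := - y1 / (y2 - y1).
have lamE : lam%:R = k%:R - (y1 + y2) + mu%:R.
  by rewrite yD /b; ring.
have phi1P : search_mode k a (1 - y1 / k%:R) (shell a al1 be1).
  apply: (shell_search_mode _ k_gt0 k_reg lamP muP).
    rewrite lamE -yM /al1 /be1; field. exact: D_neq0.
  rewrite -yM /al1 /be1; field. exact: D_neq0.
have phi2P : search_mode k a (1 - y2 / k%:R) (shell a al2 be2).
  apply: (shell_search_mode _ k_gt0 k_reg lamP muP).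
    rewrite lamE -yM /al2 /be2; field. exact: D_neq0.
  rewrite -yM /al2 /be2; field. exact: D_neq0.
have phiD x : shell a al1 be1 x + shell a al2 be2 x = (x != a)%:R.
  rewrite /shell; case: eqP => _ /=; first by rewrite addr0.
  by case: ifP => _; rewrite /al1 /al2 /be1 /be2; field.
have w_ge : 1 / 2 <= 2 * k%:R - y2.
  by apply: (@smallest_angle_bound _ k%:R b mu%:R y1 y2); rewrite /b in yD *; lra.
have c_itv (y : R) : 0 < y -> y < 2 * k%:R -> -1 < 1 - y / k%:R < 1.
  move=> y_gt0 y_lt.
  have : y / k%:R < 2 by rewrite ltr_pdivrMr; lra.
  have : 0 < y / k%:R by apply: divr_gt0; lra.
  by move=> ? ?; apply/andP; split; lra.
have c1_itv : -1 < 1 - y1 / k%:R < 1 by apply: c_itv; lra.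
have c2_itv : -1 < 1 - y2 / k%:R < 1 by apply: c_itv; lra.
have c12 : 1 - y1 / k%:R != 1 - y2 / k%:R.
  apply/eqP => /addrI /oppr_inj /(mulIf _) y12.
  by move: D_neq0; rewrite y12 ?subrr ?eqxx // invr_neq0.
rewrite (avg_search_prob_modes k_gt0 k_reg c1_itv c2_itv c12 phi1P phi2P phiD).
rewrite (eq_bigr (fun _ : G =>
    (al1 ^+ 2 / ((1 - (1 - y1 / k%:R)) * (1 + (1 - y1 / k%:R)) ^+ 2)
   + al2 ^+ 2 / ((1 - (1 - y2 / k%:R)) * (1 + (1 - y2 / k%:R)) ^+ 2)
   + (1 - al1 / (1 + (1 - y1 / k%:R)) - al2 / (1 + (1 - y2 / k%:R))) ^+ 2)
   / #|G|%:R / k%:R)); last first.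
  move=> x ax; have xa : x != a by apply: contraL ax => /eqP->; rewrite adj_irrefl.
  by rewrite /shell (negPf xa) ax natrM [(#|G|%:R * _)^-1]invfM -[RHS]mulrA.
have card_a : #|[pred x | adj a x]| = k by rewrite -[RHS](k_reg a) cardsE.
rewrite sumr_const card_a -[(_ / k%:R) *+ k]mulr_natr divfK //.
apply: (@search_value_bound R k%:R b mu%:R) => //; try lra.
  by rewrite /b; lra.
Qed.

Unset Implicit Arguments.

Theorem theorem8p4 (R : realType) (X : nat -> sgraph) (k : nat -> nat)
    (a : forall j, X j)
    (X_srg : forall j, strongly_regular (X j))
    (X_valency : forall j, k_regular (X j) (k j))
    (k_infty : k @ \oo --> \oo) :
  (fun j => avg_search_prob R (k j) (a j)) @ \oo --> (1 / 4 : R).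
Proof.
apply/cvgrPdist_le => e e_gt0.
pose N := maxn 4 (Num.truncn (250 / e)).+1.
near=> j.
have kN : (N <= k j)%N.
  near: j; have := k_infty [set n | (N <= n)%N] (nbhs_infty_ge N); exact.
have /andP[k4 kt] : ((4 <= k j) && ((Num.truncn (250 / e)).+1 <= k j))%N.
  by rewrite -geq_max.
rewrite distrC; apply: (le_trans (srg_avg_search_prob R (a j) (X_srg j) (X_valency j) k4)).
have k_gt0 : 0 < (k j)%:R :> R by rewrite ltr0n; apply: leq_trans k4.
rewrite ler_pdivrMr // -ler_pdivrMl // mulrC.
apply/ltW/(lt_le_trans (truncnS_gt _)); rewrite ?ler_nat //.
Unshelve. all: by end_near.
Qed.
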